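(* Let $n,w$ be integers with $w>3$ and $n>2w$, and let $b\in\{n-1,n,\dots,2n-1\}$. Then there is no equitable $2$-partition of the Johnson graph $J(n,w)$ with quotient matrix $$\begin{pmatrix} w(n-w)-b & b\\ 2n-2-b & w(n-w)-2n+2+b\end{pmatrix}.$$
   Context: The Johnson graph $J(n,w)$ has as vertices the binary vectors of length $n$ with exactly $w$ ones; two vertices are adjacent iff they have exactly $w-1$ common ones (i.e. they differ by swapping a $1$ and a $0$). It is regular of degree $w(n-w)$. A $2$-partition $(C_1,C_2)$ of the vertex set into two nonempty sets (cells) is equitable with quotient matrix $S=(s_{ij})_{i,j\in\{1,2\}}$ if every vertex of $C_i$ has exactly $s_{ij}$ neighbours in $C_j$. *)

(* Defs.v *)
From mathcomp Require Import all_boot all_order all_algebra.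
Set Implicit Arguments. Unset Strict Implicit. Unset Printing Implicit Defensive.

Definition johnson_vertex (n w : nat) (A : {set 'I_n}) : bool := #|A| == w.

Definition johnson_adj (n w : nat) (A B : {set 'I_n}) : bool :=
  [&& johnson_vertex w A, johnson_vertex w B & #|A :&: B| == w.-1].

Definition nbrs_in (n w : nat) (x : {set 'I_n}) (C : {set {set 'I_n}}) : nat :=
  #|[set y in C | johnson_adj w x y]|.

Definition equitable_2partition (n w : nat) (C1 : {set {set 'I_n}})
    (s11 s12 s21 s22 : int) : Prop :=
  let C2 := [set x | johnson_vertex w x & x \notin C1] in
  [/\ {subset C1 <= johnson_vertex w},
      C1 != set0, C2 != set0,
      (forall x, x \in C1 -> Posz (nbrs_in w x C1) = s11 /\ Posz (nbrs_in w x C2) = s12)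
    & (forall x, x \in C2 -> Posz (nbrs_in w x C1) = s21 /\ Posz (nbrs_in w x C2) = s22)].

(* Main.v *)
(* Let f be the indicator of C1. The matrix makes f, up to a constant, an eigenfunction of
   J(n,w) for the second eigenvalue. The difference B |-> f(B+i) - f(B+j) is then an
   eigenfunction of J(n-2,w-1) for its first eigenvalue, and its own differences are
   eigenfunctions of J(n-4,w-2) for the degree, hence constant by the maximum principle.
   So f(B+i) - f(B+j) is affine in B with integer coefficients, has mean zero and lies in
   {-1,0,1}; as n > 2w, it is either zero ("twins") or [a in B] - [b in B] ("linked").
   If {i,j} is linked to {a,b}, then {a,b} is linked to {i,j}, and all points outside
   {i,j,a,b} are twins of each other because w > 3. For such a point k, the pair {a,k} must
   be linked to {i,b} or {b,j}, which makes j or i a twin of a fresh point, contradicting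
   the link from {a,b} to {i,j}. So all pairs are twins and f is constant. *)
Require Import Defs.
From mathcomp Require Import all_boot all_order all_algebra.
From mathcomp Require Import zify ring lra.
Set Implicit Arguments. Unset Strict Implicit. Unset Printing Implicit Defensive.
Import Order.TTheory GRing.Theory Num.Theory.
Local Open Scope ring_scope.

(** * Eigenfunctions on [k]-subsets and their differences *)

(* [F] restricted to the [k]-subsets of [S] satisfies [adj F = l F + c] in the Johnson graph on [S]. *)
Definition swap_eigen (T : finType) (S : {set T}) (k : nat)
    (F : {set T} -> int) (l c : int) : Prop :=
  forall B : {set T}, B \subset S -> #|B| = k ->
  \sum_(x in B) \sum_(y in S :\: B) F (y |: (B :\ x)) = l * F B + c.

Lemma subset_avoiding (T : finType) (S : {set T}) (s : seq T) (r : nat) :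
  (r + size s <= #|S|)%N ->
  exists D : {set T}, [/\ D \subset S, #|D| = r & forall x, x \in s -> x \notin D].
Proof.
move=> le_r.
pose R := S :\: [set:: s].
have leR : (r <= #|R|)%N.
  have := cardsID [set:: s] S; rewrite -/R => cR.
  have : (#|S :&: [set:: s]| <= size s)%N.
    apply: leq_trans (subset_leq_card (subsetIr _ _)) _.
    by rewrite cardsE card_size.
  lia.
exists [set:: take r (enum R)]; split.
- by apply/subsetP=> x; rewrite inE => /mem_take; rewrite mem_enum !inE => /andP[].
- have /card_uniqP : uniq (take r (enum R)) by rewrite take_uniq ?enum_uniq.
  by rewrite cardsE => ->; rewrite size_takel // -cardE.
- move=> x xs; apply/negP; rewrite inE => /mem_take.
  by rewrite mem_enum !inE xs.
Qed.

Lemma card_swap (T : finType) (B : {set T}) (x y : T) :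
  x \in B -> y \notin B -> #|y |: (B :\ x)| = #|B|.
Proof.
move=> xB yB; rewrite cardsU1 !inE (negPf yB) andbF /=.
by rewrite (cardsD1 x B) xB.
Qed.

(** Induction on the size of [B :\: B']: trading a point of [B :\: B'] for a point of [B' :\: B],
    which exists because the two differences have equal size, lowers it. *)
Lemma swap_connected (T : finType) (S : {set T}) (P : {set T} -> Prop) :
  (forall (B : {set T}) x y, B \subset S -> P B -> x \in B -> y \in S -> y \notin B ->
     P (y |: (B :\ x))) ->
  forall B B' : {set T}, B \subset S -> B' \subset S -> #|B| = #|B'| -> P B -> P B'.
Proof.
move=> clP B B'; move: {2}_.+1 (ltnSn #|B :\: B'|) => d.
elim: d B => // d IHd B ltd sB sB' eqc PB.
have [/eqP B0|[x xB]] := set_0Vmem (B :\: B').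
  suff -> : B' = B by [].
  by apply/esym/eqP; rewrite eqEcard eqc leqnn andbT -setD_eq0.
have cDD : #|B :\: B'| = #|B' :\: B|.
  by have := cardsID B' B; have := cardsID B B'; rewrite (setIC B' B) eqc; lia.
have [y yB] : exists y, y \in B' :\: B.
  by apply/set0Pn; rewrite -card_gt0 -cDD card_gt0; apply/set0Pn; exists x.
move: xB yB; rewrite !inE => /andP[xB' xB] /andP[yB yB'].
apply: (IHd (y |: (B :\ x))).
- suff : (#|(y |: (B :\ x)) :\: B'| < #|B :\: B'|)%N by lia.
  apply: proper_card; apply/properP; split.
    apply/subsetP=> z; rewrite !inE => /andP[zB'] /orP[/eqP zy|/andP[_ ->]].
      by rewrite zy yB' in zB'.
    by rewrite zB'.
  exists x; rewrite !inE ?xB' ?xB // eqxx /= orbF.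
  by apply/negP => /eqP xy; rewrite xy yB' in xB'.
- apply/subsetP=> z; rewrite !inE => /orP[/eqP->|/andP[_ zB]].
    exact: (subsetP sB').
  exact: (subsetP sB).
- exact: sB'.
- by rewrite card_swap.
- by apply: clP => //; exact: (subsetP sB').
Qed.

(* Maximum principle: the eigenvalue is the degree of the Johnson graph on [S]. *)
Lemma harmonic_constant (T : finType) (S : {set T}) (k : nat) (F : {set T} -> int) :
  swap_eigen S k F (k * (#|S| - k))%:Z 0 ->
  forall B B' : {set T}, B \subset S -> B' \subset S -> #|B| = k -> #|B'| = k -> F B = F B'.
Proof.
move=> eF.
suff max_eq (B0 : {set T}) : B0 \subset S -> #|B0| = k ->
    (forall B : {set T}, B \subset S -> #|B| = k -> F B <= F B0) ->
    forall B : {set T}, B \subset S -> #|B| = k -> F B = F B0.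
  move=> B B' sB sB' cB cB'.
  have PB : (B \subset S) && (#|B| == k) by rewrite sB cB eqxx.
  case: (@Order.TotalTheory.arg_maxP _ _ _ B
    (fun C : {set T} => (C \subset S) && (#|C| == k)) F PB) => B0 /andP[sB0 /eqP cB0] maxB0.
  have max_eq0 := max_eq B0 sB0 cB0.
  rewrite !max_eq0 // => C sC cC; apply: maxB0;
  by rewrite sC cC eqxx.
move=> sB0 cB0 maxB0 B sB cB.
suff [] : [/\ #|B| = k & F B = F B0] by [].
apply: (swap_connected (S := S) (P := fun C => [/\ #|C| = k & F C = F B0])
          _ sB0 sB); last 2 first.
- by rewrite cB cB0.
- by [].
move=> C x y sC [cC FC] xC yS yC; split; first by rewrite card_swap.
have sw a b : a \in C -> b \in S :\: C -> F (b |: (C :\ a)) <= F B0.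
  rewrite inE => aC /andP[bC bS]; apply: maxB0; last by rewrite card_swap.
  by rewrite subUset sub1set bS (subset_trans (subD1set _ _)).
(* At a maximiser the eigenvalue equation says that the gaps to the neighbours sum to zero. All gaps
   are nonnegative, so each one vanishes and every neighbour is again a maximiser. *)
have e0 : \sum_(a in C) \sum_(b in S :\: C) (F B0 - F (b |: (C :\ a))) = 0.
  under eq_bigr do rewrite big_split /= sumrN.
  rewrite big_split /= sumrN eF // FC addr0.
  under eq_bigr do rewrite sumr_const.
  rewrite sumr_const cC cardsD (setIidPr sC) cC -mulrnA -mulr_natl.
  by rewrite mulnC natz subrr.
have /eqP := e0; rewrite psumr_eq0; last first.
  by move=> a aC; apply: sumr_ge0 => b bS; rewrite subr_ge0 sw.
move=> /allP/(_ x (mem_index_enum x)); rewrite xC /= psumr_eq0; last first.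
  by move=> b bS; rewrite subr_ge0 sw.
move=> /allP/(_ y (mem_index_enum y)); rewrite !inE yS yC /= subr_eq0.
by move/eqP.
Qed.

Lemma setU1D1 (T : finType) (B : {set T}) (x y : T) :
  x != y -> x |: B :\ y = (x |: B) :\ y.
Proof.
move=> nxy; apply/setP=> z; rewrite !inE.
by case: (eqVneq z x) => [->|]; rewrite ?nxy.
Qed.

(** The neighbours of [i |: B] are sorted by whether [i] leaves and whether [j] enters. The second
    and third sums do not change when [i] and [j] are exchanged. *)
Lemma swap_eigenU1 (T : finType) (S : {set T}) (k : nat) (F : {set T} -> int)
    (l c : int) (i j : T) (B : {set T}) :
  swap_eigen S k.+1 F l c -> i \in S -> j \in S -> i != j ->
  B \subset S :\: [set i; j] -> #|B| = k ->
  F (j |: B) + \sum_(y in S :\: [set i; j] :\: B) F (y |: B)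
  + \sum_(x in B) (F (j |: (i |: (B :\ x))))
  + \sum_(x in B) \sum_(y in S :\: [set i; j] :\: B) F (i |: (y |: (B :\ x)))
  = l * F (i |: B) + c.
Proof.
move=> eF iS jS nij sB cB.
have out x : x \in B -> (x != i) && (x != j).
  by move/(subsetP sB); rewrite !inE negb_or => /andP[].
have iB : i \notin B by apply/negP => /out; rewrite eqxx.
have jB : j \notin B by apply/negP => /out; rewrite eqxx andbF.
have eS : S :\: (i |: B) = j |: (S :\: [set i; j] :\: B).
  apply/setP=> z; rewrite !inE; case: (eqVneq z j) => [->|_].
    by rewrite eq_sym (negPf nij) (negPf jB) jS.
  by rewrite /= orbF !negb_or; case: (z == i); case: (z \in B).
have jN : j \notin S :\: [set i; j] :\: B by rewrite !inE eqxx orbT /= andbF.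
rewrite -eF; first last.
- by rewrite cardsU1 iB cB.
- rewrite subUset sub1set iS; apply: subset_trans sB (subsetDl _ _).
rewrite big_setU1 //= eS.
under [in RHS]eq_bigr => y _ do rewrite setU1K //.
rewrite big_setU1 //= -[LHS]addrA; congr (_ + _).
rewrite -big_split /=; apply: eq_bigr => x xB.
have /andP[xi xj] := out x xB.
rewrite big_setU1 //= -setU1D1 1?eq_sym //; congr (_ + _).
by apply: eq_bigr => y _; rewrite setUCA.
Qed.

(** Subtracting the expansions at [i |: B] and [j |: B] cancels [c] and the two symmetric sums. The
    single terms [F (j |: B)] and [F (i |: B)] change sides, which raises the eigenvalue by 1. *)
Lemma swap_eigen_diff (T : finType) (S : {set T}) (k : nat) (F : {set T} -> int)
    (l c : int) (i j : T) :
  swap_eigen S k.+1 F l c -> i \in S -> j \in S -> i != j ->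
  swap_eigen (S :\: [set i; j]) k (fun B => F (i |: B) - F (j |: B)) (l + 1) 0.
Proof.
move=> eF iS jS nij B sB cB.
have e1 := swap_eigenU1 eF iS jS nij sB cB.
have eij : \sum_(x in B) F (j |: (i |: (B :\ x))) = \sum_(x in B) F (i |: (j |: (B :\ x))).
  by apply: eq_bigr => x _; rewrite setUCA.
rewrite setUC in sB; rewrite eq_sym in nij.
have := swap_eigenU1 eF jS iS nij sB cB; rewrite -eij [[set j; i]]setUC => e2.
under eq_bigr => x _ do rewrite sumrB.
rewrite sumrB addr0 mulrBr !mulrDl !mul1r. lra.
Qed.

(** * First-eigenvalue functions with values in {-1,0,1} *)

Lemma card_setD2 (T : finType) (S : {set T}) (x y : T) :
  x \in S -> y \in S -> x != y -> #|S :\: [set x; y]| = (#|S| - 2)%N.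
Proof.
move=> xS yS nxy; rewrite cardsD (setIidPr _) ?cards2 ?nxy //.
by rewrite subUset !sub1set xS.
Qed.

Lemma subsetD2 (T : finType) (S D : {set T}) (x y : T) :
  (D \subset S :\: [set x; y]) = [&& D \subset S, x \notin D & y \notin D].
Proof.
by rewrite subsetD disjoint_sym disjoints_subset subUset !sub1set !inE.
Qed.

(** By the hypothesis on [l], the difference for a fixed pair [x], [y] has the degree as eigenvalue,
    so it does not depend on [D]. These constants add up along triples of points, hence come from a
    potential. *)
Lemma exchange_potential (T : finType) (S : {set T}) (k : nat) (u : {set T} -> int) (l : int) :
  (k.+2 < #|S|)%N ->
  swap_eigen S k.+1 u l 0 ->
  l + 1 = (k * (#|S| - 2 - k))%:Z ->
  exists p : T -> int, forall x y (D : {set T}), x \in S -> y \in S -> x != y ->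
    D \subset S :\: [set x; y] -> #|D| = k ->
    u (x |: D) - u (y |: D) = p x - p y.
Proof.
move=> ltk eu el.
have cst x y : x \in S -> y \in S -> x != y -> forall D D' : {set T},
    D \subset S :\: [set x; y] -> D' \subset S :\: [set x; y] -> #|D| = k -> #|D'| = k ->
    u (x |: D) - u (y |: D) = u (x |: D') - u (y |: D').
  move=> xS yS nxy D D' sD sD' cD cD'.
  apply: (harmonic_constant (S := S :\: [set x; y]) (k := k)
           (F := fun D : {set T} => u (x |: D) - u (y |: D))) => //.
  rewrite card_setD2 // -el.
  exact: swap_eigen_diff eu xS yS nxy.
have [x0 x0S] : exists x0, x0 \in S by apply/set0Pn; rewrite -card_gt0; lia.
(* The potential is measured from the base point [x0], where it is 0; its value outside [S] is
   arbitrary. *)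
have /fin_all_exists [p pP] : forall x, exists c : int,
    (x == x0 -> c = 0) /\ (x != x0 -> x \in S -> forall D : {set T}, D \subset S :\: [set x; x0] ->
       #|D| = k -> u (x |: D) - u (x0 |: D) = c).
  move=> x; have [_|nx] := eqVneq x x0; first by exists 0.
  have [xS|xS] := boolP (x \in S); last by exists 0.
  have [D [sD cD aD]] := @subset_avoiding T S [:: x; x0] k ltac:(rewrite /=; lia).
  exists (u (x |: D) - u (x0 |: D)); split=> // _ _ D' sD' cD'.
  apply: cst => //; rewrite subsetD2 sD !aD // !inE eqxx ?orbT //.
exists p => x y D xS yS nxy sD cD.
have p0 : p x0 = 0 by apply: (pP x0).1.
have px z : z != x0 -> _ := (pP z).2.
have [ex|nx] := eqVneq x x0.
  rewrite ex eq_sym in nxy; rewrite ex setUC in sD *.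
  by rewrite p0 -(px y nxy yS D sD cD); lra.
have [ey|ny] := eqVneq y x0.
  by rewrite ey in nxy sD *; rewrite p0 (px x nxy xS D sD cD); lra.
(* A common rest avoiding all three points lets the differences along [x], [x0], [y] telescope. *)
have [D' [sD' cD' aD]] := @subset_avoiding T S [:: x; y; x0] k ltac:(rewrite /=; lia).
have [xD yD zD] : [/\ x \notin D', y \notin D' & x0 \notin D'].
  by split; apply: aD; rewrite !inE eqxx ?orbT.
rewrite (cst x y xS yS nxy D D') //; last by rewrite subsetD2 sD' xD.
rewrite -(px x nx xS D') //; last by rewrite subsetD2 sD' xD.
rewrite -(px y ny yS D') //; last by rewrite subsetD2 sD' yD.
by ring.
Qed.

(** Each neighbour of [B] has value [u B - p x + p y]. Summed over all swaps, the degree times [u B]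
    cancels against the eigenvalue, which is the degree minus [#|S|], and leaves [#|S| * u B] in
    terms of [p]. *)
Lemma eigen_linear (T : finType) (S : {set T}) (k : nat) (u : {set T} -> int)
    (p : T -> int) :
  (k < #|S|)%N ->
  swap_eigen S k.+1 u ((k.+1 * (#|S| - k.+1))%:Z - #|S|%:Z) 0 ->
  (forall x y (D : {set T}), x \in S -> y \in S -> x != y ->
    D \subset S :\: [set x; y] -> #|D| = k ->
    u (x |: D) - u (y |: D) = p x - p y) ->
  forall B : {set T}, B \subset S -> #|B| = k.+1 ->
  #|S|%:Z * u B = #|S|%:Z * (\sum_(x in B) p x) - k.+1%:Z * (\sum_(x in S) p x).
Proof.
move=> ltk eu up B sB cB.
have e1 := eu B sB cB.
have : \sum_(x in B) \sum_(y in S :\: B) u (y |: (B :\ x)) =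
       \sum_(x in B) \sum_(y in S :\: B) (u B - p x + p y).
  apply: eq_bigr => x xB; apply: eq_bigr => y; rewrite inE => /andP[yB yS].
  have xS := subsetP sB x xB.
  have nyx : y != x by apply: contraNneq yB => ->.
  have cBx : #|B :\ x| = k by have := cardsD1 x B; rewrite xB cB; lia.
  have sBx : B :\ x \subset S :\: [set y; x].
    by rewrite subsetD2 (subset_trans (subD1set _ _) sB) !inE eqxx (negPf yB) andbF.
  by have := up y x _ yS xS nyx sBx cBx; rewrite setD1K //; lra.
rewrite {}e1; under [X in _ = X -> _]eq_bigr do rewrite big_split /= sumr_const.
rewrite big_split /= sumrMnl sumrB !sumr_const cardsD (setIidPr sB) cB.
rewrite [\sum_(x in S) p x](big_setID B) /= (setIidPr sB).
set P := \sum_(x in B) p x; set Q := \sum_(x in S :\: B) p x.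
rewrite !pmulrn !mulrzz.
have -> : (#|S| - k.+1)%N%:Z = #|S|%:Z - k.+1%:Z by lia.
rewrite PoszM.
have -> : (#|S| - k.+1)%N%:Z = #|S|%:Z - k.+1%:Z by lia.
move: (#|S|%:Z) (k.+1%:Z) (u B) => m K U e.
by rewrite [U * K]mulrC in e; lra.
Qed.

(** Replacing the three [x]'s by the three [y]'s, over a common rest [D], raises [u] by at least 3,
    while its range has width 2. *)
Lemma three_increases (T : finType) (S : {set T}) (k : nat) (u : {set T} -> int)
    (p : T -> int) (x1 x2 x3 y1 y2 y3 : T) :
  (k + 6 <= #|S|)%N ->
  (forall B : {set T}, B \subset S -> #|B| = k.+3 -> -1 <= u B <= 1) ->
  (forall B B' : {set T}, B \subset S -> B' \subset S -> #|B| = k.+3 -> #|B'| = k.+3 ->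
     u B - u B' = \sum_(x in B) p x - \sum_(x in B') p x) ->
  {subset [:: x1; y1; x2; y2; x3; y3] <= S} ->
  uniq [:: x1; y1; x2; y2; x3; y3] ->
  p x1 < p y1 -> p x2 < p y2 -> p x3 < p y3 -> False.
Proof.
move=> leS ub du sS un lt1 lt2 lt3.
have [D [sD cD aD]] := @subset_avoiding T S [:: x1; y1; x2; y2; x3; y3] k leS.
have ext a b c : a \in S -> b \in S -> c \in S -> uniq [:: a; b; c] ->
    a \notin D -> b \notin D -> c \notin D ->
    let B := a |: (b |: (c |: D)) in
    [/\ B \subset S, #|B| = k.+3 & \sum_(x in B) p x = p a + p b + p c + \sum_(x in D) p x].
  move=> aS bS cS /=; rewrite !inE negb_or andbT => /andP[/andP[ab ac] bc] aD' bD cD'.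
  split.
  - by rewrite !subUset !sub1set aS bS cS.
  - by rewrite !cardsU1 !inE !negb_or ab ac bc aD' bD cD' cD.
  - by rewrite !big_setU1 ?inE ?negb_or ?ab ?ac ?bc //= !addrA.
have inS z : z \in [:: x1; y1; x2; y2; x3; y3] -> z \in S by apply: sS.
have [ux uy] : uniq [:: x1; x2; x3] /\ uniq [:: y1; y2; y3].
  move: un; rewrite /= !inE !negb_or => /and5P[] /and5P[_ -> _ -> _] /and4P[_ -> _ ->].
  by move=> /and3P[_ -> _] /andP[_ ->].
have [|||||||sx cx ex] := ext x1 x2 x3 => //;
  try (by [apply: inS; rewrite !inE eqxx ?orbT | apply: aD; rewrite !inE eqxx ?orbT]).
have [|||||||sy cy ey] := ext y1 y2 y3 => //;
  try (by [apply: inS; rewrite !inE eqxx ?orbT | apply: aD; rewrite !inE eqxx ?orbT]).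
have := du _ _ sx sy cx cy; have := ub _ sx cx; have := ub _ sy cy.
rewrite ex ey; lia.
Qed.

Lemma perm_swap2 (T : eqType) (a b : T) : perm_eq [:: a; b] [:: b; a].
Proof. by rewrite (perm_catC [:: a] [:: b]). Qed.

Lemma three_unequal_pairs (T : finType) (S : {set T}) (k : nat) (u : {set T} -> int)
    (p : T -> int) (x1 x2 x3 y1 y2 y3 : T) :
  (k + 6 <= #|S|)%N ->
  (forall B : {set T}, B \subset S -> #|B| = k.+3 -> -1 <= u B <= 1) ->
  (forall B B' : {set T}, B \subset S -> B' \subset S -> #|B| = k.+3 -> #|B'| = k.+3 ->
     u B - u B' = \sum_(x in B) p x - \sum_(x in B') p x) ->
  {subset [:: x1; y1; x2; y2; x3; y3] <= S} ->
  uniq [:: x1; y1; x2; y2; x3; y3] ->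
  p x1 != p y1 -> p x2 != p y2 -> p x3 != p y3 -> False.
Proof.
move=> leS ub du.
have main a1 b1 a2 b2 a3 b3 : perm_eq [:: a1; b1; a2; b2; a3; b3] [:: x1; y1; x2; y2; x3; y3] ->
    {subset [:: x1; y1; x2; y2; x3; y3] <= S} ->
    uniq [:: x1; y1; x2; y2; x3; y3] ->
    p a1 < p b1 -> p a2 < p b2 -> p a3 < p b3 -> False.
  move=> pe sS un; apply: (three_increases leS ub du).
  - by move=> z; rewrite (perm_mem pe); apply: sS.
  - by rewrite (perm_uniq pe).
move=> sS un.
case: (ltgtP (p x1) (p y1)) => // l1 _; case: (ltgtP (p x2) (p y2)) => // l2 _;
  case: (ltgtP (p x3) (p y3)) => // l3 _;
  refine (main _ _ _ _ _ _ _ sS un l1 l2 l3);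
  by do 2![apply: (@perm_cat _ [:: _; _] [:: _; _]); rewrite ?perm_refl ?perm_swap2 //].
Qed.

(** Disjoint pairs with unequal [p] are chosen greedily; there are at most two, and [p] is a
    constant [t] off them. If three of their points had a value other than [t], matching them with
    three outside points would give three unequal pairs. *)
Lemma nearly_constant (T : finType) (S : {set T}) (k : nat) (u : {set T} -> int)
    (p : T -> int) :
  (k + 6 <= #|S|)%N -> (7 <= #|S|)%N ->
  (forall B : {set T}, B \subset S -> #|B| = k.+3 -> -1 <= u B <= 1) ->
  (forall B B' : {set T}, B \subset S -> B' \subset S -> #|B| = k.+3 -> #|B'| = k.+3 ->
     u B - u B' = \sum_(x in B) p x - \sum_(x in B') p x) ->
  exists a b t, [/\ a \in S, b \in S, a != b &
    forall x, x \in S -> x != a -> x != b -> p x = t].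
Proof.
move=> leS S7 ub du.
have no3 := @three_unequal_pairs T S k u p _ _ _ _ _ _ leS ub du.
have pick (s : seq T) : (size s <= 6)%N -> exists z, z \in S /\ z \notin s.
  move=> le6; have lts := leq_ltn_trans le6 S7.
  have [D [sD cD aD]] := @subset_avoiding T S s 1 lts.
  have /eqP/cards1P[z Dz] := cD; exists z; split.
    by apply: (subsetP sD); rewrite Dz inE.
  by apply/negP => /aD; rewrite Dz inE eqxx.
have dich (s : seq T) : (size s <= 6)%N ->
    (exists t, forall x, x \in S -> x \notin s -> p x = t) \/
    (exists x y, [/\ x \in S, y \in S, x \notin s, y \notin s & p x != p y]).
  move=> /pick[z [zS zs]].
  have [/forallP al|] := boolP [forall x, (x \in S) && (x \notin s) ==> (p x == p z)].
    left; exists (p z) => x xS xs; have := al x; rewrite xS xs => /eqP->//.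
  rewrite negb_forall => /existsP[x]; rewrite negb_imply => /andP[/andP[xS xs] ne].
  by right; exists x, z.
have [[t ct]|[x1 [y1 [x1S y1S _ _ ne1]]]] := dich [::] isT.
  have [a [aS _]] := pick [::] isT.
  have [b [bS ba]] := pick [:: a] isT.
  exists a, b, t; split=> //; first by move: ba; rewrite inE eq_sym.
  by move=> x xS _ _; apply: ct.
have n1 : x1 != y1 by apply: contraNneq ne1 => ->.
have [[t ct]|] := dich [:: x1; y1] isT.
  exists x1, y1, t; split=> // x xS xx xy; apply: ct => //.
  by rewrite !inE negb_or xx xy.
move=> [x2 [y2 []]]; rewrite !inE !negb_or => x2S y2S /andP[x21 x2y1] /andP[y2x1 y2y1] ne2.
have n2 : x2 != y2 by apply: contraNneq ne2 => ->.
have [[t ct]|] := dich [:: x1; y1; x2; y2] isT; last first.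
  move=> [x3 [y3 []]]; rewrite !inE !negb_or => x3S y3S /and4P[? ? ? ?] /and4P[? ? ? ?] ne3.
  case: (no3 x1 x2 x3 y1 y2 y3) => //.
    by apply/allP => /=; rewrite x1S y1S x2S y2S x3S y3S.
  have n3 : x3 != y3 by apply: contraNneq ne3 => ->.
  rewrite /= !inE !negb_or.
  by repeat (apply/andP; split); first [done | rewrite eq_sym].
have [z1 [z1S]] := pick [:: x1; y1; x2; y2] isT.
have [z2 [z2S]] := pick [:: x1; y1; x2; y2; z1] isT.
have [z3 [z3S]] := pick [:: x1; y1; x2; y2; z1; z2] isT.
move=> z3N z2N z1N.
have pz1 : p z1 = t by apply: ct.
have pz2 : p z2 = t by apply: ct => //; move: z2N; rewrite !inE !negb_or => /and5P[-> -> -> -> _].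
have pz3 : p z3 = t by apply: ct => //; move: z3N; rewrite !inE !negb_or => /and5P[-> -> -> -> _].
(* Three exceptional points would pair off with [z1], [z2], [z3]. *)
have exc a b c : uniq [:: a; b; c] -> {subset [:: a; b; c] <= [:: x1; y1; x2; y2]} ->
    p a != t -> p b != t -> p c != t -> False.
  move=> un sub pa pb pc.
  have inS v : v \in [:: x1; y1; x2; y2] -> v \in S.
    by rewrite !inE => /or4P[] /eqP->.
  have zN v : v \in [:: x1; y1; x2; y2] -> [/\ v != z1, v != z2 & v != z3].
    move=> vs; split.
    - by apply: contraNneq z1N => <-.
    - by apply: contraNneq z2N => <-; move: vs; rewrite !inE => /or4P[] ->; rewrite ?orbT.
    - by apply: contraNneq z3N => <-; move: vs; rewrite !inE => /or4P[] ->; rewrite ?orbT.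
  have aI : a \in [:: x1; y1; x2; y2] by apply: sub; rewrite !inE eqxx.
  have bI : b \in [:: x1; y1; x2; y2] by apply: sub; rewrite !inE eqxx orbT.
  have cI : c \in [:: x1; y1; x2; y2] by apply: sub; rewrite !inE eqxx !orbT.
  have [[a1 a2 a3] [b1 b2 b3] [c1 c2 c3]] := And3 (zN a aI) (zN b bI) (zN c cI).
  have z12 : z1 != z2 by apply: contraNneq z2N => <-; rewrite !inE eqxx !orbT.
  have z13 : z1 != z3 by apply: contraNneq z3N => <-; rewrite !inE eqxx !orbT.
  have z23 : z2 != z3 by apply: contraNneq z3N => <-; rewrite !inE eqxx !orbT.
  apply: (no3 a b c z1 z2 z3); rewrite ?pz1 ?pz2 ?pz3 //.
    by apply/allP => /=; rewrite (inS a) // (inS b) // (inS c) // z1S z2S z3S.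
  move: un; rewrite /= !inE !negb_or !andbT => /andP[/andP[ab ac] bc].
  by repeat (apply/andP; split); first [done | rewrite eq_sym].
have pair a a' b b' : perm_eq [:: a; a'; b; b'] [:: x1; y1; x2; y2] -> p a != p a' -> p b != p b' ->
   p a != t -> p b != t -> (p a' = t) /\ (p b' = t).
  move=> pe na nb pa pb.
  have un : uniq [:: a; a'; b; b'].
    rewrite (perm_uniq pe) /= !inE !negb_or n1 n2 (eq_sym x1) x21 (eq_sym x1) y2x1.
    by rewrite eq_sym x2y1 eq_sym y2y1.
  have sub v : v \in [:: a; a'; b; b'] -> v \in [:: x1; y1; x2; y2] by rewrite (perm_mem pe).
  move: un; rewrite /= !inE !negb_or !andbT => /and3P[/and3P[u1 u2 u3] /andP[u4 u5] u6].
  split; apply/eqP/negPn/negP => h.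
    apply: (exc a a' b) => //=; first by rewrite !inE negb_or u1 u2 u4.
    by move=> v vI; apply: sub; move: vI; rewrite !inE => /or3P[] ->; rewrite ?orbT.
  apply: (exc a b b') => //=; first by rewrite !inE negb_or u2 u3 u6.
  by move=> v vI; apply: sub; move: vI; rewrite !inE => /or3P[] ->; rewrite ?orbT.
have fin a a' b b' : perm_eq [:: a; a'; b; b'] [:: x1; y1; x2; y2] -> p a != p a' -> p b != p b' ->
    a \in S -> b \in S -> a != b -> p a != t -> p b != t ->
    exists a b t, [/\ a \in S, b \in S, a != b &
      forall x, x \in S -> x != a -> x != b -> p x = t].
  move=> pe na nb aS bS nab pa pb; have [pa' pb'] := pair a a' b b' pe na nb pa pb.
  exists a, b, t; split=> // x xS xa xb.
  have [xI|/ct->//] := boolP (x \in [:: x1; y1; x2; y2]).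
  move: xI; rewrite -(perm_mem pe) !inE (negPf xa) (negPf xb) /=.
  by case/orP => /eqP->.
(* In each unequal pair some member has a value other than [t]; these two members are the
   exceptional points. *)
have [e1|h1] := eqVneq (p x1) t; have [e2|h2] := eqVneq (p x2) t.
- apply: (fin y1 x1 y2 x2); rewrite // 1?eq_sym //; try by [rewrite -e1 | rewrite -e2].
  by apply: (@perm_cat _ [:: _; _] [:: _; _]); rewrite ?perm_refl ?perm_swap2.
- apply: (fin y1 x1 x2 y2); rewrite // 1?eq_sym //; try by [rewrite -e1].
  by apply: (@perm_cat _ [:: _; _] [:: _; _]); rewrite ?perm_refl ?perm_swap2.
- apply: (fin x1 y1 y2 x2); rewrite // 1?eq_sym //; try by [rewrite -e2].
  by apply: (@perm_cat _ [:: _; _] [:: _; _]); rewrite ?perm_refl ?perm_swap2.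
- apply: (fin x1 y1 x2 y2); rewrite // 1?eq_sym //.
Qed.

Lemma sum_nearly_constant (T : finType) (S : {set T}) (p : T -> int) (a b : T) (t : int) :
  a != b -> (forall x, x \in S -> x != a -> x != b -> p x = t) ->
  forall B : {set T}, B \subset S ->
  \sum_(x in B) p x
  = t * #|B|%:Z + (p a - t) * (a \in B)%:Z + (p b - t) * (b \in B)%:Z.
Proof.
move=> nab pt B sB.
have -> : \sum_(x in B) p x =
    \sum_(x in B) (t + ((if x == a then p a - t else 0) + (if x == b then p b - t else 0))).
  apply: eq_bigr => x xB; have [->|xa] := eqVneq x a.
    by rewrite (negPf nab); lra.
  have [->|xb] := eqVneq x b; first lra.
  by rewrite (pt x) ?(subsetP sB) //; lra.
have pick1 c (s : int) : \sum_(x in B) (if x == c then s else 0) = s * (c \in B)%:Z.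
  rewrite -big_mkcondr /=; have [cB|cB] := boolP (c \in B).
    rewrite (big_pred1 c) ?mulr1 // => x /=.
    by case: (eqVneq x c) => [->|_]; rewrite ?cB ?andbF.
  rewrite big1 ?mulr0 // => x /andP[xB /eqP xc].
  by rewrite -xc xB in cB.
by rewrite !big_split /= !pick1 sumr_const pmulrn mulrzz addrA.
Qed.

(** The right side has absolute value at most [2 * k.+1], below [m], so the multiple [m * U] of [m]
    is 0. *)
Lemma small_multiple (m k : nat) (s U : int) :
  (2 * k.+1 < m)%N -> -2 <= s <= 2 -> -1 <= U <= 1 ->
  m%:Z * U = - (k.+1%:Z * s) -> s = 0.
Proof.
move=> ltm s2 U1.
have : U \in [:: -1; 0; 1] by rewrite !inE; lia.
have : s \in [:: -2; -1; 0; 1; 2] by rewrite !inE; lia.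
by rewrite !inE => /or4P[/eqP->|/eqP->|/eqP->|/orP[] /eqP->] // /or3P[] /eqP->; lia.
Qed.

Lemma small_eigenfunction (T : finType) (S : {set T}) (k : nat) (u : {set T} -> int) :
  (2 * k.+3 < #|S|)%N ->
  (forall B : {set T}, B \subset S -> #|B| = k.+3 -> -1 <= u B <= 1) ->
  swap_eigen S k.+3 u ((k.+3 * (#|S| - k.+3))%:Z - #|S|%:Z) 0 ->
  (forall B : {set T}, B \subset S -> #|B| = k.+3 -> u B = 0) \/
  exists a b, [/\ a \in S, b \in S, a != b &
    forall B : {set T}, B \subset S -> #|B| = k.+3 -> u B = (a \in B)%:Z - (b \in B)%:Z].
Proof.
move=> ltS ub eu.
have [||p up] := exchange_potential _ eu; first by lia.
  (* With [d] the size of the complement, the eigenvalue condition is [k.+3 * d - (d + k.+3) + 1 =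
     k.+2 * (d - 1)]. *)
  have [d dE] : exists d, #|S| = (d + k.+3)%N by exists (#|S| - k.+3)%N; lia.
  have -> : (#|S| - k.+3 = d)%N by lia.
  have -> : (#|S| - 2 - k.+2 = d.-1)%N by lia.
  rewrite dE; case: d dE => [|d] dE; first by lia.
  have : (k.+3 * d.+1 + 1 = k.+2 * d + (d.+1 + k.+3))%N by rewrite mulnS !mulSn; lia.
  by rewrite /=; move: (k.+3 * d.+1)%N (k.+2 * d)%N => X Y; lia.
have ltk : (k.+2 < #|S|)%N by lia.
have lin := eigen_linear ltk eu up.
have m0 : #|S|%:Z != 0 by lia.
have du (B B' : {set T}) : B \subset S -> B' \subset S -> #|B| = k.+3 -> #|B'| = k.+3 ->
     u B - u B' = \sum_(x in B) p x - \sum_(x in B') p x.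
  move=> sB sB' cB cB'; have := lin B sB cB; have := lin B' sB' cB'.
  by move=> e1 e2; apply: (mulfI m0); rewrite !mulrBr e1 e2; lra.
have [||a [b [t [aS bS nab pt]]]] := nearly_constant _ _ ub du; [by lia|by lia|].
have sumB := sum_nearly_constant nab pt.
have nba : b != a by rewrite eq_sym.
set v := p a - t in sumB; set v' := p b - t in sumB.
have mu (B : {set T}) : B \subset S -> #|B| = k.+3 -> #|S|%:Z * u B =
    #|S|%:Z * (v * (a \in B)%:Z + v' * (b \in B)%:Z) - k.+3%:Z * (v + v').
  by move=> sB cB; rewrite lin // !sumB // cB aS bS /=; lra.
(* The rests [D0], [D1], [D2] are to be completed by none, one or both of [a], [b]. Comparing both
   with none bounds [v + v']; comparing [a] with [b] bounds [v - v']. *)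
have [D0 [sD0 cD0 aD0]] := @subset_avoiding T S [:: a; b] k.+3 ltac:(rewrite /=; lia).
have [D1 [sD1 cD1 aD1]] := @subset_avoiding T S [:: a; b] k.+2 ltac:(rewrite /=; lia).
have [D2 [sD2 cD2 aD2]] := @subset_avoiding T S [:: a; b] k.+1 ltac:(rewrite /=; lia).
have [[A0 B0] [A1 B1] [A2 B2]] : [/\ a \notin D0 /\ b \notin D0,
    a \notin D1 /\ b \notin D1 & a \notin D2 /\ b \notin D2].
  by split; split; (apply: aD0 || apply: aD1 || apply: aD2); rewrite !inE eqxx ?orbT.
have S1 c : c \in S -> c \notin D1 -> c |: D1 \subset S /\ #|c |: D1| = k.+3.
  by move=> cS cD; rewrite subUset sub1set cS sD1 cardsU1 cD cD1.
have [sa ca] := S1 a aS A1; have [sb cb] := S1 b bS B1.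
have [s2 c2] : a |: (b |: D2) \subset S /\ #|a |: (b |: D2)| = k.+3.
  by rewrite !subUset !sub1set aS bS sD2 !cardsU1 !inE negb_or nab A2 B2 cD2.
have sum2 : -2 <= v + v' <= 2.
  have := ub _ sD0 cD0; have := ub _ s2 c2; have := du _ _ s2 sD0 c2 cD0.
  rewrite !sumB // c2 cD0 !inE !eqxx /= (negPf A0) (negPf B0) orbT /= !mulr1 !mulr0.
  move: (u _) (u _) => U U'; lra.
have diff2 : -2 <= v - v' <= 2.
  have := ub _ sa ca; have := ub _ sb cb; have := du _ _ sa sb ca cb.
  rewrite !sumB // ca cb !inE !eqxx /= (negPf A1) (negPf B1) (negPf nab) (negPf nba) /= !mulr1 !mulr0.
  move: (u _) (u _) => U U'; lra.
(* [u D0] is an integer equal to [- k.+3 * (v + v') / #|S|], of absolute value below 1. *)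
have vv0 : v + v' = 0.
  have := mu _ sD0 cD0; have := ub _ sD0 cD0.
  rewrite (negPf A0) (negPf B0) /= !mulr0 sub0r => uD e.
  exact: small_multiple ltS sum2 uD e.
have {}mu (B : {set T}) : B \subset S -> #|B| = k.+3 -> u B = v * (a \in B)%:Z - v * (b \in B)%:Z.
  move=> sB cB; have := mu B sB cB; rewrite -(addr0_eq vv0).
  by move=> e; apply: (mulfI m0); rewrite e; lra.
have : v \in [:: -1; 0; 1] by rewrite !inE; clear -vv0 diff2; lia.
rewrite !inE => /or3P[] /eqP ev; rewrite {}ev in mu.
- right; exists b, a; split=> // B sB cB; rewrite mu //; lra.
- by left=> B sB cB; rewrite mu // !mul0r subrr.
- by right; exists a, b; split=> // B sB cB; rewrite mu // !mul1r.
Qed.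

(** * Twins and linked pairs *)

(** Here and below [k] is the size of the rest [B]; [f] is evaluated at sets with one more point. *)
Definition twins (T : finType) (k : nat) (f : {set T} -> int) (i j : T) : Prop :=
  forall B : {set T}, i \notin B -> j \notin B -> #|B| = k -> f (i |: B) = f (j |: B).

Definition linked (T : finType) (k : nat) (f : {set T} -> int) (i j a b : T) : Prop :=
  uniq [:: i; j; a; b] /\
  forall B : {set T}, i \notin B -> j \notin B -> #|B| = k ->
  f (i |: B) - f (j |: B) = (a \in B)%:Z - (b \in B)%:Z.

Definition dichotomy (T : finType) (k : nat) (f : {set T} -> int) : Prop :=
  forall i j, i != j -> twins k f i j \/ exists a b, linked k f i j a b.

Lemma avoiding (T : finType) (s : seq T) (r : nat) : (r + size s <= #|T|)%N ->
  exists D : {set T}, #|D| = r /\ forall x, x \in s -> x \notin D.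
Proof.
rewrite -cardsT => /subset_avoiding[D [_ cD aD]]; by exists D.
Qed.

Lemma fresh (T : finType) (s : seq T) : (size s < #|T|)%N -> exists z, z \notin s.
Proof.
move=> lts; have [D [/eqP/cards1P[z ->] aD]] := @avoiding T s 1 lts; exists z.
by apply/negP => /aD; rewrite inE eqxx.
Qed.

(** A difference of 1 between two integers in [0,1] determines both, so a link fixes [f] at these
    four sets. *)
Lemma linked_values (T : finType) (k : nat) (f : {set T} -> int) (i j a b : T) (C : {set T}) :
  (forall A, 0 <= f A <= 1) -> linked k.+1 f i j a b ->
  i \notin C -> j \notin C -> a \notin C -> b \notin C -> #|C| = k ->
  [/\ f (i |: (a |: C)) = 1, f (j |: (a |: C)) = 0,
      f (i |: (b |: C)) = 0 & f (j |: (b |: C)) = 1].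
Proof.
move=> f01 [/=]; rewrite !inE !negb_or !andbT => /and3P[/and3P[ij ia ib] /andP[ja jb] ab] L.
move=> iC jC aC bC cC.
have := L (a |: C); have := L (b |: C).
rewrite !cardsU1 aC bC cC !inE !negb_or ia ib ja jb iC jC !eqxx (negPf aC) (negPf bC).
rewrite eq_sym in ab; rewrite (negPf ab) eq_sym (negPf ab) /=.
move=> /(_ isT isT erefl) e1 /(_ isT isT erefl) e2.
have := f01 (i |: (a |: C)); have := f01 (j |: (a |: C)).
have := f01 (i |: (b |: C)); have := f01 (j |: (b |: C)).
move: e1 e2; clear; move: (f _) (f _) (f _) (f _) => *; split; lia.
Qed.

(** By the four known values, exchanging [a] with [b] changes [f] by 1 beside [i] and by -1 beside
    [j]. So [a], [b] are linked to some [x], [y]; a rest avoiding [x] (or [y]) would rule out the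
    value 1 (or -1) unless [x = i] (or [y = j]). *)
Lemma linked_sym (T : finType) (k : nat) (f : {set T} -> int) (i j a b : T) :
  (k + 5 <= #|T|)%N -> (forall A, 0 <= f A <= 1) -> dichotomy k.+1 f ->
  linked k.+1 f i j a b -> linked k.+1 f a b i j.
Proof.
move=> leT f01 dich L.
have un := L.1; move: (un); rewrite /= !inE !negb_or !andbT.
move=> /and3P[/and3P[ij ia ib] /andP[ja jb] ab].
have ct (C : {set T}) : i \notin C -> j \notin C -> a \notin C -> b \notin C -> #|C| = k ->
   [/\ a \notin i |: C, b \notin i |: C, #|i |: C| = k.+1 & f (a |: (i |: C)) - f (b |: (i |: C)) = 1]
   /\ [/\ a \notin j |: C, b \notin j |: C, #|j |: C| = k.+1 & f (a |: (j |: C)) - f (b |: (j |: C)) = -1].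
  move=> iC jC aC bC cC; have [e1 e2 e3 e4] := linked_values f01 L iC jC aC bC cC.
  rewrite ![a |: (_ |: _)]setUCA ![b |: (_ |: _)]setUCA e1 e2 e3 e4.
  rewrite !cardsU1 iC jC cC !inE !negb_or !(eq_sym a) !(eq_sym b) ia ib ja jb aC bC.
  by [].
have av v : exists C : {set T}, [/\ v \notin C, i \notin C, j \notin C, a \notin C & b \notin C] /\ #|C| = k.
  have [C [cC aC]] := @avoiding T [:: v; i; j; a; b] k leT.
  by exists C; split=> //; split; apply: aC; rewrite !inE eqxx ?orbT.
case: (dich a b ab) => [tw|[x [y L']]].
  have [C [[_ iC jC aC bC] cC]] := av a.
  have [[h1 h2 h3]] := (ct C iC jC aC bC cC).1.
  by rewrite tw // subrr.
suff [<- <-] : x = i /\ y = j by [].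
split; apply/eqP/negPn/negP => ne.
  have [C [[xC iC jC aC bC] cC]] := av x.
  have [[h1 h2 h3]] := (ct C iC jC aC bC cC).1.
  by rewrite L'.2 // [x \in _]inE inE (negPf ne) (negPf xC) /=; case: (y \in _).
have [C [[xC iC jC aC bC] cC]] := av y.
have [[h1 h2 h3]] := (ct C iC jC aC bC cC).2.
by rewrite L'.2 // [y \in _]inE inE (negPf ne) (negPf xC) /=; case: (x \in _).
Qed.

(** Replacing [a] or [b] by a twin [l] would preserve the difference between [i] and [j], but the
    link makes it 1 or -1 before and 0 after. *)
Lemma linked_not_twins (T : finType) (k : nat) (f : {set T} -> int) (i j a b l : T) :
  (k + 5 <= #|T|)%N -> linked k.+1 f i j a b -> l \notin [:: i; j; a; b] ->
  ~ twins k.+1 f a l /\ ~ twins k.+1 f b l.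
Proof.
move=> leT [un L] lN.
have [C [cC aC]] := @avoiding T [:: l; i; j; a; b] k leT.
have [iC jC aC' bC lC] : [/\ i \notin C, j \notin C, a \notin C, b \notin C & l \notin C].
  by split; apply: aC; rewrite !inE eqxx ?orbT.
move: un lN; rewrite /= !inE !negb_or !andbT.
move=> /and3P[/and3P[ij ia ib] /andP[ja jb] ab] /and4P[li lj la lb].
have tw c : (c == a) || (c == b) -> twins k.+1 f c l ->
    f (i |: (c |: C)) - f (j |: (c |: C)) = f (i |: (l |: C)) - f (j |: (l |: C)).
  move=> cab tcl.
  have [ci cj cl cC'] : [/\ c != i, c != j, c != l & c \notin C].
    by case/orP: cab => /eqP->; split=> //; rewrite eq_sym.
  rewrite ![i |: (_ |: _)]setUCA ![j |: (_ |: _)]setUCA !tcl //;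
    by rewrite ?cardsU1 ?iC ?jC ?cC // !inE negb_or ?ci ?cj ?li ?lj ?cC' ?lC.
have card1 c : c \notin C -> #|c |: C| = k.+1 by move=> h; rewrite cardsU1 h cC.
have no c : (c == a) || (c == b) -> twins k.+1 f c l -> False.
  move=> cab /(tw c cab).
  have [ci cj cl cC'] : [/\ c != i, c != j, c != l & c \notin C].
    by case/orP: cab => /eqP->; split=> //; rewrite eq_sym.
  rewrite !L ?card1 // ?[_ \in _ |: C]inE ?[_ \in [set _]]inE ?negb_or 1?eq_sym ?ci ?cj ?iC ?jC //.
  all: rewrite ?inE ?negb_or ?[i == _]eq_sym ?[j == _]eq_sym ?ci ?cj ?li ?lj ?iC ?jC //.
  rewrite ![_ == l]eq_sym (negPf la) (negPf lb) (negPf aC') (negPf bC) /= !orbF.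
  case/orP: cab => /eqP->; rewrite eqxx ?[b == a]eq_sym (negPf ab) //.
by split; apply: no; rewrite eqxx ?orbT.
Qed.

(* This is where sets of size at least 4 are needed: [B] meets both linked pairs and
   still has room for an arbitrary further point. *)
Lemma linked_twins (T : finType) (r : nat) (f : {set T} -> int) (i j a b k l : T) :
  (r + 8 <= #|T|)%N -> (forall A, 0 <= f A <= 1) -> dichotomy r.+3 f ->
  linked r.+3 f i j a b -> k \notin [:: i; j; a; b] -> l \notin [:: i; j; a; b] -> k != l ->
  twins r.+3 f k l.
Proof.
move=> leT f01 dich L.
have leT7 : (r.+1 + 7 <= #|T|)%N by rewrite addSnnS.
move=> kN lN kl.
case: (dich k l kl) => // -[x [y [un' L']]]; exfalso.
have un := L.1; move: (un); rewrite /= !inE !negb_or !andbT.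
move=> /and3P[/and3P[ij ia ib] /andP[ja jb] ab].
move: un'; rewrite /= !inE !negb_or !andbT.
move=> /and3P[/and3P[_ kx ky] /andP[lx ly] xy].
(* If [k], [l] were linked to [x], [y], a set containing [x] but not [y] would separate them. The
   test set [t |: (s |: C)] is built this way, with [s] from [a], [b] and [t] from [i], [j]; if [x]
   is none of these four points, it goes into [C]. *)
have choose2 (c d : T) : c != d ->
    exists s, [/\ s \in [:: c; d], s != y & x \in [:: c; d] -> s = x].
  move=> cd; have [xcd|] := boolP (x \in [:: c; d]); first by exists x.
  have [ey|ny] := eqVneq c y.
    by exists d; rewrite !inE eqxx orbT -ey eq_sym cd.
  by exists c; rewrite !inE eqxx.
have [s [sI sy sx]] := choose2 a b ab.
have [t [tI ty tx]] := choose2 i j ij.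
have [C [cC [aC xC]]] : exists C : {set T}, #|C| = r.+1 /\
    (forall v, v \in [:: i; j; a; b; k; l; y] -> v \notin C) /\
    (x \notin [:: i; j; a; b] -> x \in C).
  have [xI|xN] := boolP (x \in [:: i; j; a; b]).
    have [C [cC aC]] := @avoiding T [:: i; j; a; b; k; l; y] r.+1 leT7.
    by exists C.
  have [C [cC aC]] := @avoiding T [:: x; i; j; a; b; k; l; y] r leT.
  exists (x |: C); split; first by rewrite cardsU1 cC aC // inE eqxx.
  split; last by rewrite !inE eqxx.
  move=> v vI; rewrite 2!inE negb_or (aC v); last by rewrite inE vI orbT.
  rewrite andbT.
  apply/eqP => vx; move: vI xN; rewrite vx !inE.
  by rewrite (eq_sym x k) (eq_sym x l) (negPf kx) (negPf lx) (negPf xy) !orbF => ->.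
have [iC jC aC' bC] : [/\ i \notin C, j \notin C, a \notin C & b \notin C].
  by split; apply: aC; rewrite !inE eqxx ?orbT.
have [kC lC yC] : [/\ k \notin C, l \notin C & y \notin C].
  by split; apply: aC; rewrite !inE eqxx ?orbT.
(* The link between [i], [j] and [a], [b], applied with rest [m |: C], fixes this value
   independently of [m], so [k] and [l] give the same one. *)
have val m : m \notin [:: i; j; a; b] -> m \notin C ->
    f (m |: (t |: (s |: C))) =
    (((t == i) && (s == a)) || ((t == j) && (s == b)))%:Z.
  rewrite !inE !negb_or => /and4P[mi mj ma mb] mC.
  have := @linked_values T r.+2 f i j a b (m |: C) f01 L.
  rewrite cardsU1 mC cC !inE !negb_or.
  rewrite ![_ == m]eq_sym mi mj ma mb iC jC aC' bC => /(_ isT isT isT isT erefl).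
  move=> -[e1 e2 e3 e4]; rewrite (setUCA [set m] [set t]) (setUCA [set m] [set s]).
  move: sI tI; rewrite !inE => /orP[] /eqP-> /orP[] /eqP->; rewrite ?e1 ?e2 ?e3 ?e4 ?eqxx.
  - by [].
  - by rewrite [j == i]eq_sym (negPf ij) (negPf ab) andbF.
  - by rewrite [b == a]eq_sym (negPf ab) (negPf ij) andbF.
  - by rewrite orbT.
have nst m : m \notin [:: i; j; a; b] -> (m != s) && (m != t).
  rewrite !inE !negb_or => /and4P[mi mj ma mb].
  by move: sI tI; rewrite !inE => /orP[] /eqP-> /orP[] /eqP->; rewrite ?mi ?mj ?ma ?mb.
have [/andP[ks kt] /andP[ls lt]] := (nst k kN, nst l lN).
have st : t != s.
  by move: sI tI; rewrite !inE => /orP[] /eqP-> /orP[] /eqP->; rewrite // eq_sym.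
have [sC tC] : s \notin C /\ t \notin C.
  by move: sI tI; rewrite !inE => /orP[] /eqP-> /orP[] /eqP->.
have := L' (t |: (s |: C)); rewrite !val // subrr.
rewrite !cardsU1 !inE !negb_or ks kt ls lt kC lC sC tC st cC => /(_ isT isT erefl).
rewrite ![y == _]eq_sym (negPf sy) (negPf ty) (negPf yC) /= subr0.
suff -> : [|| x == t, x == s | x \in C] by [].
have [xab|xab] := boolP (x \in [:: a; b]); first by rewrite (sx xab) eqxx orbT.
have [xij|xij] := boolP (x \in [:: i; j]); first by rewrite (tx xij) eqxx.
rewrite xC ?orbT //.
by move: xab xij; rewrite !inE !negb_or => /andP[-> ->] /andP[-> ->].
Qed.

Lemma linked_impossible (T : finType) (r : nat) (f : {set T} -> int) (i j a b : T) :
  (r + 9 <= #|T|)%N -> (forall A, 0 <= f A <= 1) -> dichotomy r.+3 f ->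
  ~ linked r.+3 f i j a b.
Proof.
move=> leT f01 dich L'.
have leT5 : (r.+2 + 5 <= #|T|)%N by lia.
have leT8 : (r + 8 <= #|T|)%N by lia.
have leT7 : (r.+2 + 7 <= #|T|)%N by rewrite !addSnnS.
have fr (s : seq T) : (size s <= 7)%N -> exists z, z \notin s.
  by move=> le7; apply: fresh; apply: leq_ltn_trans le7 _; lia.
have L := linked_sym leT5 f01 dich L'.
have un := L.1; move: (un); rewrite /= !inE !negb_or !andbT.
move=> /and3P[/and3P[ab ai aj] /andP[bi bj] ij].
have [k kN] := fr [:: a; b; i; j] isT.
have [l0 l0N] := fr [:: a; b; i; j; k] isT.
move: (kN) (l0N); rewrite !inE !negb_or => /and4P[ka kb ki kj] /and5P[la lb li lj lk].
have ak : a != k by rewrite eq_sym.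
(* By [L], [f] is 1 at [a |: (i |: D)] and 0 at [a |: (j |: D)]; by [L'], it agrees at the two sets
   with [k] for [a]. So the double difference is 1, which excludes twins [a], [k]. *)
have key x y : exists D : {set T}, [/\ x \notin D, y \notin D & [/\
    #|D| = r.+2, a \notin i |: D, k \notin i |: D, a \notin j |: D & k \notin j |: D]] /\
    f (a |: (i |: D)) - f (k |: (i |: D)) - (f (a |: (j |: D)) - f (k |: (j |: D))) = 1 /\
    (i \notin D /\ j \notin D).
  have [D [cD aD]] := @avoiding T [:: x; y; a; b; i; j; k] r.+2 leT7.
  have [aD' bD iD jD kD] : [/\ a \notin D, b \notin D, i \notin D, j \notin D & k \notin D].
    by split; apply: aD; rewrite !inE eqxx ?orbT.
  exists D; split; first split; try by apply: aD; rewrite !inE eqxx ?orbT.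
    by split=> //; rewrite !inE negb_or ?ai ?aj ?ki ?kj.
  split=> //.
  have [e1 e2 e3 e4] := linked_values f01 L aD' bD iD jD cD.
  rewrite e1 e3 ![k |: (_ |: _)]setUCA.
  have := L'.2 (k |: D); rewrite cardsU1 kD cD !inE !negb_or ![_ == k]eq_sym ki kj iD jD.
  by rewrite (negPf ka) (negPf kb) (negPf aD') (negPf bD) => /(_ isT isT erefl) /=; lra.
case: (dich a k ak) => [tw|[x [y Lk]]].
  have [D [[_ _ [cD h1 h2 h3 h4]] [e [iD jD]]]] := key a a.
  have c1 c : c \notin D -> #|c |: D| = r.+3 by move=> h; rewrite cardsU1 h cD.
  by move: e; rewrite !tw ?c1 // !subrr.
have unk := Lk.1; move: (unk); rewrite /= !inE !negb_or !andbT.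
move=> /and3P[/and3P[_ ax ay] /andP[kx ky] xy].
(* For a link to [x], [y] the double difference is [[x = i] - [x = j] - [y = i] + [y = j]]. It
   equals 1, so exactly one of [x = i], [y = j] holds. *)
have : [\/ x = i /\ y != j | y = j /\ x != i].
  have [D [[xD yD [cD h1 h2 h3 h4]] [e [iD jD]]]] := key x y.
  have c1 c : c \notin D -> #|c |: D| = r.+3 by move=> h; rewrite cardsU1 h cD.
  move: e; rewrite !Lk.2 ?c1 // !inE (negPf xD) (negPf yD) !orbF.
  have [ex|nx] := eqVneq x i; have [ey|ny] := eqVneq y j => //=.
  - by rewrite ex ey [j == i]eq_sym (negPf ij).
  - by constructor 1.
  - by constructor 2.
  - by case: (y == i); case: (x == j).
(* Any point besides [b] in the second pair of [a], [k] would be a twin of a fresh point. *)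
have far z : z \in [:: x; y] -> z \notin [:: a; b; i; j] -> False.
  move=> zI zN; have [l] := fr [:: a; b; i; j; k; x; y] isT.
  rewrite !inE !negb_or => /and5P[l1 l2 l3 l4 /and3P[l5 l6 l7]].
  have tw : twins r.+3 f z l.
    apply: (linked_twins leT8 f01 dich L) => //.
      by rewrite !inE !negb_or l1 l2 l3 l4.
    by move: zI; rewrite !inE => /orP[] /eqP->; rewrite eq_sym.
  have [|n1 n2] := @linked_not_twins T r.+2 f a k x y l leT5 Lk.
    by rewrite !inE !negb_or l1 l5 l6 l7.
  by move: zI tw; rewrite !inE => /orP[] /eqP->.
have lN4 : l0 \notin [:: a; b; i; j] by rewrite !inE !negb_or la lb li lj.
have [ni nj] := linked_not_twins leT5 L lN4.
case=> [[ex ny]|[ey nx]].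
- have yb : y = b.
    apply/eqP/negPn/negP => yb; apply: (far y); rewrite !inE ?eqxx ?orbT //.
    by rewrite !negb_or [y == a]eq_sym ay yb [y == i]eq_sym -ex xy ny.
  rewrite ex yb in Lk; apply: nj.
  by apply: (linked_twins leT8 f01 dich Lk); rewrite 1?eq_sym // !inE !negb_or ?[j == _]eq_sym
    ?aj ?kj ?ij ?bj ?la ?lk ?li ?lb.
- have xb : x = b.
    apply/eqP/negPn/negP => xb; apply: (far x); rewrite !inE ?eqxx ?orbT //.
    by rewrite !negb_or [x == a]eq_sym ax xb nx -ey xy.
  rewrite ey xb in Lk; apply: ni.
  by apply: (linked_twins leT8 f01 dich Lk); rewrite 1?eq_sym // !inE !negb_or
    ?[i == a]eq_sym ?[i == b]eq_sym ?[i == k]eq_sym ?ai ?ki ?ij ?bi ?la ?lk ?lj ?lb.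
Qed.

(** * From equitable partitions to eigenfunctions *)

(** A neighbour [B] of [A] determines its swap: [x] is the only point of [A :\: B] and [y] the only
    point of [B :\: A]. *)
Lemma nbrs_in_swap (n w : nat) (C : {set {set 'I_n}}) (A : {set 'I_n}) :
  (0 < w)%N -> #|A| = w -> {subset C <= johnson_vertex w} ->
  (nbrs_in w A C)%:Z =
  \sum_(x in A) \sum_(y in [set: 'I_n] :\: A) (y |: (A :\ x) \in C)%:Z.
Proof.
move=> w0 cA sC.
pose sw (q : 'I_n * 'I_n) := q.2 |: (A :\ q.1).
have inj : {in [pred q | (q.1 \in A) && (q.2 \in [set: 'I_n] :\: A)] &, injective sw}.
  move=> [x y] [x' y'] /=; rewrite !inE !andbT /= => /andP[xA yA] /andP[x'A y'A] e.
  have ex : x = x'.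
    have := congr1 (fun B : {set _} => x \in B) e; rewrite !inE eqxx xA !andbT /= orbF.
    rewrite (negPf (_ : x != y)); last by apply: contraNneq yA => <-.
    rewrite (negPf (_ : x != y')); last by apply: contraNneq y'A => <-.
    by move=> /esym/negbFE/eqP.
  have := congr1 (fun B : {set _} => y \in B) e.
  by rewrite !inE /= eqxx (negPf yA) !andbF !orbF => /esym/eqP ->; rewrite ex.
have -> : nbrs_in w A C =
    #|[set sw q | q in [pred q | [&& q.1 \in A, q.2 \in [set: 'I_n] :\: A & sw q \in C]]]|.
  apply: eq_card => B; rewrite !inE; apply/idP/imsetP.
    case/andP => BC /and3P[_ /eqP cB /eqP cAB].
    have cA' : #|A :\: B| = 1%N by have := cardsID B A; rewrite cAB cA; lia.
    have cB' : #|B :\: A| = 1%N by have := cardsID A B; rewrite setIC cAB cB; lia.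
    have /cards1P[x eAx] : #|A :\: B| == 1%N by rewrite cA'.
    have /cards1P[y eBy] : #|B :\: A| == 1%N by rewrite cB'.
    have eB : B = sw (x, y).
      apply/setP=> z; rewrite !inE.
      have := congr1 (fun D : {set _} => z \in D) eAx.
      have := congr1 (fun D : {set _} => z \in D) eBy.
      rewrite !inE => <- <-; by case: (z \in A); case: (z \in B).
    exists (x, y) => //; rewrite inE /= -eB BC andbT.
    have : x \in A :\: B by rewrite eAx inE.
    have : y \in B :\: A by rewrite eBy inE.
    by rewrite !inE => /andP[-> _] /andP[_ ->].
  case=> -[x y]; rewrite !inE /= andbT => /and3P[xA yA sC'] ->.
  rewrite sC' /johnson_adj /johnson_vertex cA eqxx card_swap // cA eqxx /=.
  have -> : A :&: sw (x, y) = A :\ x.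
    apply/setP=> z; rewrite !inE; case: (boolP (z \in A)) => zA /=; rewrite ?andbF //.
    by rewrite andbT (negPf (_ : z != y)) //; apply: contraNneq yA => <-.
  by apply/eqP; rewrite -cA (cardsD1 x A) xA.
rewrite card_in_imset; last first.
  move=> q q'; rewrite !inE => /and3P[a1 a2 _] /and3P[b1 b2 _].
  by apply: inj; rewrite !inE ?a1 ?b1.
rewrite pair_big_dep /= -sum1_card (big_morph Posz PoszD (erefl 0%:Z)).
rewrite [RHS](bigID (fun q => sw q \in C)) /= [RHS]addrC [X in _ = X + _]big1 ?add0r; last first.
  by move=> q /andP[_ /negPf]; rewrite /sw => ->.
apply: eq_big => [q|q]; first by rewrite !inE; case: (_ \in A); case: (_ \in A).
by case/and3P => _ _; rewrite /sw => ->.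
Qed.

Theorem theorem2 (n w b : nat) :
  (3 < w)%N -> (2 * w < n)%N -> (n - 1 <= b <= 2 * n - 1)%N ->
  ~ (exists C1 : {set {set 'I_n}},
       equitable_2partition w C1
         ((w * (n - w))%:Z - b%:Z) b%:Z
         ((2 * n - 2)%:Z - b%:Z) ((w * (n - w))%:Z - (2 * n - 2)%:Z + b%:Z)).
Proof.
move=> w3 ltn _ [C1 [sC1 /set0Pn[A AC1] /set0Pn[A']]].
rewrite inE => /andP[/eqP cA' A'C1] e1 e2.
have /eqP cA := sC1 A AC1.
case: w => [|[|[|[|r]]]] // in w3 ltn sC1 e1 e2 cA cA' *.
pose f (B : {set 'I_n}) := (B \in C1)%:Z.
have f01 B : 0 <= f B <= 1 by rewrite /f; case: (B \in C1).
(* Both rows of the matrix give one affine equation: the first-column entries differ by the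
   eigenvalue, and the lower one is the constant term. *)
have ef : swap_eigen [set: 'I_n] r.+4 f
    ((r.+4 * (n - r.+4))%:Z - (2 * n - 2)%:Z) ((2 * n - 2)%:Z - b%:Z).
  move=> B _ cB; rewrite -(nbrs_in_swap (ltn0Sn _) cB sC1) /f.
  have [BC1|BC1] := boolP (B \in C1).
    by rewrite (e1 B BC1).1 mulr1 addrA subrK.
  by rewrite (e2 B _).1 ?mulr0 ?add0r // inE BC1 /johnson_vertex cB eqxx.
have leT : (r + 9 <= #|'I_n|)%N by rewrite card_ord; lia.
have dich : dichotomy r.+3 f.
  move=> i j ij.
  have := swap_eigen_diff ef (in_setT i) (in_setT j) ij.
  set S := [set: 'I_n] :\: [set i; j]; set u := (fun B : {set 'I_n} => _) => eu.
  have cS : #|S| = (n - 2)%N by rewrite card_setD2 ?inE // cardsT card_ord.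
  have sS (B : {set 'I_n}) : i \notin B -> j \notin B -> B \subset S.
    by move=> iB jB; rewrite subsetD2 subsetT iB jB.
  have ltS : (2 * r.+3 < #|S|)%N by rewrite cS; lia.
  have ub (B : {set 'I_n}) : B \subset S -> #|B| = r.+3 -> -1 <= u B <= 1.
    move=> _ _; have := f01 (i |: B); have := f01 (j |: B); rewrite /u.
    by move: (f _) (f _); clear; lia.
  have [|tw|[a [b' [aS bS nab L]]]] := @small_eigenfunction _ S r u ltS ub.
  - suff -> : (r.+3 * (#|S| - r.+3))%:Z - #|S|%:Z =
        (r.+4 * (n - r.+4))%:Z - (2 * n - 2)%:Z + 1 by [].
    have [d dE] : exists d, n = (d + r.+4)%N by exists (n - r.+4)%N; clear -ltn; lia.
    rewrite cS dE addnK; have -> : (d + r.+4 - 2 - r.+3 = d.-1)%N by clear; lia.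
    have : (0 < d)%N by clear -ltn dE; lia.
    case: d {dE} => [|d] // _ /=; rewrite !mulSn !mulnS; clear; lia.
  - by left=> B iB jB cB; apply/eqP; rewrite -subr_eq0; apply/eqP; apply: tw => //; exact: sS.
  right; exists a, b'; split; last by move=> B iB jB cB; apply: L => //; exact: sS.
  move: aS bS; rewrite !inE !andbT !negb_or => /andP[ai aj] /andP[bi bj].
  by rewrite /= !inE !negb_or ij nab ![_ == a]eq_sym ![_ == b']eq_sym ai aj bi bj.
(* Since all pairs are twins, [C1] is closed under swaps, so it would spread from [A] to [A']. *)
suff [_] : #|A'| = r.+4 /\ A' \in C1 by apply/negP.
apply: (swap_connected (S := [set: 'I_n])
          (P := fun B : {set 'I_n} => #|B| = r.+4 /\ B \in C1)
          _ (subsetT A) (subsetT A')); rewrite ?cA ?cA' //.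
move=> B x y _ [cB BC1] xB _ yB; split; first by rewrite card_swap.
have xy : x != y by apply: contraNneq yB => <-.
case: (dich x y xy) => [tw|[a [b' L]]]; last by case: (linked_impossible leT f01 dich L).
have := tw (B :\ x); rewrite /f setD1K // BC1 !inE eqxx (negPf yB) andbF.
have cBx : #|B :\ x| = r.+3 by have := cardsD1 x B; rewrite xB cB; lia.
by move=> /(_ isT isT cBx); case: (_ \in C1).
Qed.
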